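(* Let $M_1,M_2\in\mathbb{S}^n$ and let $$\mathcal{S}(\{M_1,M_2\})=\{X\in\mathbb{S}^n_+:\ \langle M_1,X\rangle\ge 0,\ \langle M_2,X\rangle\ge 0\}.$$ Then $\mathcal{S}(\{M_1,M_2\})$ is rank-one generated if and only if one of the following holds: (i) there exists $(\alpha_1,\alpha_2)\neq(0,0)$ such that $\alpha_1M_1+\alpha_2M_2\in\mathbb{S}^n_+$, or (ii) there exist $a,b,c\in\mathbb{R}^n$ such that $M_1=\mathrm{Sym}(ac^\top)$ and $M_2=\mathrm{Sym}(bc^\top)$.
   Context: $\mathbb{S}^n$ is the space of real symmetric $n\times n$ matrices with inner product $\langle A,B\rangle=\mathrm{tr}(AB)$, and $\mathbb{S}^n_+$ the cone of positive semidefinite matrices. For $M\in\mathbb{R}^{n\times n}$, $\mathrm{Sym}(M)=(M+M^\top)/2$. A closed convex cone $\mathcal{S}\subseteq\mathbb{S}^n_+$ is called rank-one generated (ROG) if $\mathcal{S}=\mathrm{conv}(\mathcal{S}\cap\{xx^\top: x\in\mathbb{R}^n\})$. *)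

(* Defs.v *)
From HB Require Import structures.
From mathcomp Require Import all_boot all_order all_algebra.
From mathcomp Require Import reals.
Set Implicit Arguments. Unset Strict Implicit. Unset Printing Implicit Defensive.
Import Order.TTheory GRing.Theory Num.Theory.
Local Open Scope ring_scope.

Section Defs.
Variables (R : realType) (n : nat).

Definition symmx (A : 'M[R]_n) : Prop := A^T = A.

Definition psdmx (A : 'M[R]_n) : Prop :=
  symmx A /\ forall x : 'cV[R]_n, 0 <= (x^T *m A *m x) 0 0.

Definition inner (A B : 'M[R]_n) : R := \tr (A *m B).

Definition Symm (M : 'M[R]_n) : 'M[R]_n := 2^-1 *: (M + M^T).

Definition S2 (M1 M2 : 'M[R]_n) : 'M[R]_n -> Prop :=
  fun X => psdmx X /\ 0 <= inner M1 X /\ 0 <= inner M2 X.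

Definition conv (S : 'M[R]_n -> Prop) : 'M[R]_n -> Prop :=
  fun X => exists (k : nat) (lam : 'I_k -> R) (Y : 'I_k -> 'M[R]_n),
    [/\ forall i, 0 <= lam i, \sum_(i < k) lam i = 1,
        forall i, S (Y i) & X = \sum_(i < k) lam i *: Y i].

Definition ROG (S : 'M[R]_n -> Prop) : Prop :=
  forall X, S X <-> conv (fun Y => S Y /\ exists x : 'cV[R]_n, Y = x *m x^T) X.

End Defs.

(* Main.v *)
Require Import Defs.
From HB Require Import structures.
From mathcomp Require Import all_boot all_order all_algebra.
From mathcomp Require Import boolp classical_sets reals ring lra.
Set Implicit Arguments. Unset Strict Implicit. Unset Printing Implicit Defensive.
Import Order.TTheory GRing.Theory Num.Theory.
Local Open Scope ring_scope.

(* Write [M(x) = x^T M x] and [M(x,y) = x^T M y].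

   Sufficiency rests on the Sturm-Zhang decomposition: if [X] is psd and [<N,X> >= 0],
   then [X] is a sum of [x x^T] with [N(x) >= 0], obtained by rotating pairs of summands
   of opposite sign. Under (i) one applies it to a suitable [N] in the span of [M1, M2];
   under (ii) one splits off the rank-one term along [X c].

   Necessity: suppose (i) fails and put [N = M2]. By Finsler's lemma there are [N]-isotropic
   [x], [z] with [M1(x) > 0 > M1(z)]. Once [M1(z)] is scaled to [- M1(x)], the matrix
   [x x^T + z z^T] lies in the cone with both constraints tight, and being a sum of rank-one
   elements of the cone it forces [N(x,z) = 0]. As this holds for all such pairs, moving [x]
   along the quadric [N = 0] shows that [N] vanishes on the hyperplane orthogonal to [v = N x],
   so [N = Sym(u v^T)]. Finally [M1] vanishes on the hyperplane orthogonal to [u], because a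
   vector [w] there with [M1(w) <> 0] could be paired with [x] or [z], and [N(x,w)] or
   [N(z,w)] would be nonzero after a small perturbation of [w]. Hence [u] is the common
   factor. *)

(** * Bilinear forms, dot products and the trace inner product *)

Section Forms.
Variables (R : realType) (n : nat).
Implicit Types (M N X Y P : 'M[R]_n) (x y z u v w c h k : 'cV[R]_n).

Definition bform M x y : R := (x^T *m M *m y) 0 0.
Definition dot x y : R := (x^T *m y) 0 0.

Lemma bformDl M x y z : bform M (x + y) z = bform M x z + bform M y z.
Proof. by rewrite /bform linearD !mulmxDl mxE. Qed.

Lemma bformDr M x y z : bform M z (x + y) = bform M z x + bform M z y.
Proof. by rewrite /bform mulmxDr mxE. Qed.

Lemma bformZl M a x y : bform M (a *: x) y = a * bform M x y.
Proof. by rewrite /bform linearZ -!scalemxAl mxE. Qed.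

Lemma bformZr M a x y : bform M x (a *: y) = a * bform M x y.
Proof. by rewrite /bform -scalemxAr mxE. Qed.

Definition bform_lin := (bformDl, bformDr, bformZl, bformZr).

Lemma bformDm M N x y : bform (M + N) x y = bform M x y + bform N x y.
Proof. by rewrite /bform mulmxDr mulmxDl mxE. Qed.

Lemma bformZm a M x y : bform (a *: M) x y = a * bform M x y.
Proof. by rewrite /bform -scalemxAr -scalemxAl mxE. Qed.

Definition bform_linm := (bformDm, bformZm).

Lemma trmx11 (A : 'M[R]_1) : A 0 0 = A^T 0 0.
Proof. by rewrite mxE. Qed.

Lemma bformC M x y : symmx M -> bform M x y = bform M y x.
Proof.
by move=> sM; rewrite /bform trmx11 !trmx_mul trmxK sM mulmxA.
Qed.

Lemma dotC x y : dot x y = dot y x.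
Proof. by rewrite /dot trmx11 trmx_mul trmxK. Qed.

Lemma dotDr x y z : dot z (x + y) = dot z x + dot z y.
Proof. by rewrite /dot mulmxDr mxE. Qed.

Lemma dotZr a x y : dot x (a *: y) = a * dot x y.
Proof. by rewrite /dot -scalemxAr mxE. Qed.

Lemma dotDl x y z : dot (x + y) z = dot x z + dot y z.
Proof. by rewrite dotC dotDr ![dot z _]dotC. Qed.

Lemma dotZl a x y : dot (a *: x) y = a * dot x y.
Proof. by rewrite dotC dotZr dotC. Qed.

Lemma dot_mulmx M x y : dot x (M *m y) = bform M x y.
Proof. by rewrite /dot /bform mulmxA. Qed.

Lemma dot_ge0 x : 0 <= dot x x.
Proof. by rewrite /dot mxE sumr_ge0 // => i _; rewrite mxE -expr2 sqr_ge0. Qed.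

Lemma dot_eq0 x : (dot x x == 0) = (x == 0).
Proof.
apply/idP/eqP => [|->]; last by rewrite /dot mulmx0 mxE.
rewrite /dot mxE psumr_eq0 => [/allP x0|i _]; last by rewrite mxE -expr2 sqr_ge0.
apply/matrixP => i j; rewrite ord1 !mxE.
by move: (x0 i (mem_index_enum i)); rewrite mxE -expr2 sqrf_eq0 => /eqP.
Qed.

Lemma dot_gt0 x : x != 0 -> 0 < dot x x.
Proof. by move=> x0; rewrite lt_neqAle dot_ge0 eq_sym dot_eq0 x0. Qed.

Lemma bform_outer x y z w : bform (x *m y^T) z w = dot z x * dot y w.
Proof.
rewrite /bform /dot mulmxA -(mulmxA (z^T *m x)).
by rewrite [X in (X *m _)]mx11_scalar mul_scalar_mx mxE.
Qed.

Lemma bform_Symm x y z :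
  bform (Symm (x *m y^T)) z z = dot x z * dot y z.
Proof.
rewrite /Symm bform_linm bformDm trmx_mul trmxK !bform_outer !(dotC z); lra.
Qed.

Lemma inner_outer M x : inner M (x *m x^T) = bform M x x.
Proof. by rewrite /inner mulmxA mxtrace_mulC mulmxA /mxtrace big_ord1. Qed.

Lemma innerDr M X Y : inner M (X + Y) = inner M X + inner M Y.
Proof. by rewrite /inner mulmxDr mxtraceD. Qed.

Lemma innerZr M a X : inner M (a *: X) = a * inner M X.
Proof. by rewrite /inner -scalemxAr mxtraceZ. Qed.

Lemma innerDl M N X : inner (M + N) X = inner M X + inner N X.
Proof. by rewrite /inner mulmxDl mxtraceD. Qed.

Lemma innerZl M a X : inner (a *: M) X = a * inner M X.
Proof. by rewrite /inner -scalemxAl mxtraceZ. Qed.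

Lemma inner_sum (I : Type) (r : seq I) M (F : I -> 'M[R]_n) :
  inner M (\sum_(i <- r) F i) = \sum_(i <- r) inner M (F i).
Proof. by rewrite /inner mulmx_sumr raddf_sum. Qed.

Lemma bform_sum (I : Type) (r : seq I) (F : I -> 'M[R]_n) x y :
  bform (\sum_(i <- r) F i) x y = \sum_(i <- r) bform (F i) x y.
Proof. by rewrite /bform mulmx_sumr mulmx_suml summxE. Qed.

Lemma inner_sum_outer (s : seq 'cV[R]_n) M :
  inner M (\sum_(x <- s) x *m x^T) = \sum_(x <- s) bform M x x.
Proof. by rewrite inner_sum; apply: eq_bigr => x _; rewrite inner_outer. Qed.

Lemma symmxD M N : symmx M -> symmx N -> symmx (M + N).
Proof. by rewrite /symmx => sM sN; rewrite linearD /= sM sN. Qed.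

Lemma symmxZ a M : symmx M -> symmx (a *: M).
Proof. by rewrite /symmx => sM; rewrite linearZ /= sM. Qed.

Lemma symmx_outer x : symmx (x *m x^T).
Proof. by rewrite /symmx trmx_mul trmxK. Qed.

Lemma symmx_Symm M : symmx (Symm M).
Proof. by apply: symmxZ; rewrite /symmx linearD /= trmxK addrC. Qed.

Lemma psdmx_outer x : psdmx (x *m x^T).
Proof.
split=> [|y]; first exact: symmx_outer.
by rewrite -/(bform _ y y) bform_outer dotC -expr2 sqr_ge0.
Qed.

Lemma bform_delta M i j : bform M (delta_mx i 0) (delta_mx j 0) = M i j.
Proof. by rewrite /bform trmx_delta -mulmxA -colE -rowE !mxE. Qed.

Lemma symmx_bform_inj M N :
  symmx M -> symmx N -> (forall x, bform M x x = bform N x x) -> M = N.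
Proof.
move=> sM sN e; apply/matrixP => i j; rewrite -!bform_delta.
have := e (delta_mx i 0 + delta_mx j 0).
rewrite !bform_lin !e (bformC _ (delta_mx j 0) sM) (bformC _ (delta_mx j 0) sN).
lra.
Qed.

(** * Positive semidefinite matrices and their rank-one decompositions *)

Lemma psdmx_CS X x y : psdmx X ->
  bform X x y ^+ 2 <= bform X x x * bform X y y.
Proof.
move=> [sX pX]; have {}pX z : 0 <= bform X z z by exact: pX.
have := pX y; rewrite le_eqVlt => /orP[/eqP y0|y_gt0].
  have [->|b0] := eqVneq (bform X x y) 0; first by rewrite -y0 mulr0 expr0n.
  (* [s] makes the form at [x - s y] equal to -1, against positivity. *)
  pose s := (bform X x x + 1) / (2 * bform X x y).
  have := pX (x + (- s) *: y); rewrite !bform_lin -y0 (bformC y x sX).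
  have -> : bform X x x + - s * bform X x y +
     (- s * bform X x y + - s * (- s * 0)) = -1 by rewrite /s; field.
  lra.
(* This value factors as [X(y) (X(x) X(y) - X(x,y)^2)], and [X(y) > 0] cancels. *)
have := pX (bform X y y *: x + (- bform X x y) *: y).
rewrite !bform_lin (bformC y x sX) => h.
rewrite -subr_ge0 -(pmulr_rge0 _ y_gt0); apply: le_trans h _.
by rewrite le_eqVlt; apply/orP; left; apply/eqP; ring.
Qed.

(** Cauchy-Schwarz at [X c] and [c] bounds [|X c|^4] by a multiple of [X(c) = 0]. *)
Lemma psdmx_ker X c : psdmx X -> bform X c c = 0 -> X *m c = 0.
Proof.
move=> pX c0; apply/eqP; rewrite -dot_eq0 dot_mulmx -sqrf_eq0.
by rewrite eq_le sqr_ge0 andbT; have := psdmx_CS (X *m c) c pX; rewrite c0 mulr0.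
Qed.

(** Positivity of the difference is Cauchy-Schwarz; the scaling of [x] makes [c] isotropic for it,
    hence a kernel vector. *)
Lemma psdmx_peel X c : psdmx X -> 0 < bform X c c ->
  let x := (Num.sqrt (bform X c c))^-1 *: (X *m c) in
  psdmx (X - x *m x^T) /\ (X - x *m x^T) *m c = 0.
Proof.
move=> pX c_gt0 x; have sX := pX.1.
have dx y : dot y x = (Num.sqrt (bform X c c))^-1 * bform X y c.
  by rewrite dotZr dot_mulmx.
have s2 : (Num.sqrt (bform X c c)) ^+ 2 = bform X c c by rewrite sqr_sqrtr // ltW.
have s0 : Num.sqrt (bform X c c) != 0 by rewrite gt_eqF // sqrtr_gt0.
have pY : psdmx (X - x *m x^T).
  split=> [|y]; first by rewrite -scaleN1r; apply: symmxD => //; apply/symmxZ/symmx_outer.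
  rewrite -/(bform _ y y) -scaleN1r !bform_linm bform_outer (dotC x) !dx.
  rewrite mulN1r subr_ge0 mulrACA -invfM -expr2 s2 -expr2 mulrC ler_pdivrMr //.
  exact: psdmx_CS.
split=> //; apply: psdmx_ker => //.
rewrite -scaleN1r !bform_linm bform_outer (dotC x) !dx.
rewrite mulN1r mulrACA -invfM -expr2 s2 mulKf ?subrr // gt_eqF //.
Qed.

(** Cholesky elimination: the basis vectors are peeled off in turn, until the remainder annihilates
    all of them. *)
Lemma psdmx_sum_outer X : psdmx X ->
  exists s : seq 'cV[R]_n, X = \sum_(x <- s) x *m x^T.
Proof.
move=> pX.
have step m : exists (s : seq 'cV[R]_n) Y,
    [/\ psdmx Y, X = \sum_(x <- s) x *m x^T + Y &
        forall i : 'I_n, (i < m)%N -> Y *m delta_mx i 0 = 0 :> 'cV_n].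
  elim: m => [|m [s [Y [pY eX Y0]]]].
    by exists [::], X; split=> //; rewrite big_nil add0r.
  have [ltmn|lenm] := ltnP m n; last first.
    exists s, Y; split=> // i _; apply: Y0; exact: leq_trans (ltn_ord i) lenm.
  pose e : 'cV[R]_n := delta_mx (Ordinal ltmn) 0.
  have [e0|e_neq0] := eqVneq (bform Y e e) 0.
    exists s, Y; split=> // i; rewrite ltnS leq_eqVlt => /orP[/eqP im|/Y0 //].
    have -> : i = Ordinal ltmn by apply: val_inj.
    exact: psdmx_ker.
  have e_gt0 : 0 < bform Y e e by rewrite lt_neqAle eq_sym e_neq0; exact: pY.2.
  have [] := psdmx_peel pY e_gt0; set x := _ *: _ => pZ Z0.
  exists (x :: s), (Y - x *m x^T); split=> //.
    by rewrite big_cons [RHS]addrC addrA subrK addrC.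
  move=> i; rewrite ltnS leq_eqVlt => /orP[/eqP im|im].
    by have -> : i = Ordinal ltmn by apply: val_inj.
  (* Earlier kernel vectors survive: [x] is a multiple of [Y e], hence orthogonal to the kernel of
     [Y]. *)
  have Yi := Y0 _ im; apply: psdmx_ker => //.
  have xi : dot (delta_mx i 0) x = 0.
    by rewrite dotZr dot_mulmx (bformC (delta_mx i 0) e pY.1) -[bform _ e (delta_mx i 0)]dot_mulmx Yi /dot mulmx0 mxE mulr0.
  by rewrite -scaleN1r !bform_linm bform_outer xi mul0r mulr0 addr0 -dot_mulmx Yi /dot mulmx0 mxE.
have [s [Y [pY eX Y0]]] := step n.
exists s; rewrite eX; suff -> : Y = 0 by rewrite addr0.
apply/matrixP => i j; rewrite mxE -bform_delta -dot_mulmx Y0 //.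
by rewrite /dot mulmx0 mxE.
Qed.

(** * Sturm-Zhang decomposition *)

Lemma isotropic_combination M x y : symmx M ->
  bform M x x < 0 -> 0 < bform M y y ->
  exists t, bform M (t *: x + y) (t *: x + y) = 0.
Proof.
move=> sM x_lt0 y_gt0.
set a := bform M x x in x_lt0 *; set d := bform M y y in y_gt0 *; pose b := bform M x y.
(* Since [a < 0 < d], the quadratic in [t] has a real root. *)
have D0 : 0 <= b ^+ 2 - a * d by have := sqr_ge0 b; nra.
exists ((- b + Num.sqrt (b ^+ 2 - a * d)) / a).
have s2 := sqr_sqrtr D0; move: (Num.sqrt _) s2 => s s2.
rewrite !bform_lin (bformC y x sM) -/a -/b -/d.
have a0 : a != 0 by rewrite lt_eqF.
transitivity ((s ^+ 2 - (b ^+ 2 - a * d)) / a); first by field.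
by rewrite s2 subrr mul0r.
Qed.

(** With [r^2 (1 + t^2) = 1] the new pair is an orthogonal transform of [(x, y)], which preserves
    the sum of outer products; [t] makes its first vector isotropic. *)
Lemma isotropic_rotation M x y : symmx M ->
  bform M x x < 0 -> 0 < bform M y y ->
  exists z w, z *m z^T + w *m w^T = x *m x^T + y *m y^T /\ bform M z z = 0.
Proof.
move=> sM x_lt0 y_gt0; have [t t0] := isotropic_combination sM x_lt0 y_gt0.
have s_gt0 : 0 < 1 + t ^+ 2 by have := sqr_ge0 t; lra.
pose r := (Num.sqrt (1 + t ^+ 2))^-1.
have r2 : r ^+ 2 = (1 + t ^+ 2)^-1 by rewrite exprVn sqr_sqrtr // ltW.
exists (r *: (t *: x + y)), (r *: (x - t *: y)).
split; last by rewrite bformZl bformZr t0 !mulr0.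
apply/matrixP => i j; rewrite !mxE !big_ord1 !mxE.
set xi := x i 0; set xj := x j 0; set yi := y i 0; set yj := y j 0.
transitivity (r ^+ 2 * (1 + t ^+ 2) * (xi * xj + yi * yj)); first ring.
by rewrite r2 mulVf ?mul1r // gt_eqF.
Qed.

(** Induction on the length: a negative and a positive summand are traded for an isotropic one, set
    aside, and another one that rejoins the shorter list. *)
Lemma sum_outer_nonneg M (s : seq 'cV[R]_n) : symmx M ->
  0 <= \sum_(x <- s) bform M x x ->
  exists s' : seq 'cV[R]_n, \sum_(x <- s') x *m x^T = \sum_(x <- s) x *m x^T /\
    forall x, x \in s' -> 0 <= bform M x x.
Proof.
move=> sM; elim: {s}(size s) {-2}s (leqnn (size s)) => [|m IH] s.
  by rewrite leqn0 size_eq0 => /eqP -> _; exists [::].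
move=> szs s_ge0.
have [/allP sN|/allPn[x xs]] := boolP (all (fun x => 0 <= bform M x x) s).
  by exists s.
rewrite -ltNge => x_lt0.
have ps := perm_to_rem xs.
move: s_ge0; rewrite (perm_big _ ps) /= big_cons => s_ge0.
have [/hasP[y ys y_gt0]|/hasPn sN] := boolP (has (fun x => 0 < bform M x x) (rem x s)).
  have [z [w [ezw z0]]] := isotropic_rotation sM x_lt0 y_gt0.
  have ps' := perm_to_rem ys.
  pose s0 := rem y (rem x s).
  have exy : bform M z z + bform M w w = bform M x x + bform M y y.
    by rewrite -!inner_outer -!innerDr ezw.
  have [||s' [es' s'N]] := IH (w :: s0).
  - move: szs; rewrite (perm_size ps) /= (perm_size ps') /=.
    by rewrite ltnS.
  - rewrite big_cons; move: s_ge0; rewrite (perm_big _ ps') /= big_cons -/s0; lra.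
  exists (z :: s'); split; last by move=> v; rewrite inE => /orP[/eqP->|/s'N//]; rewrite z0.
  rewrite (perm_big _ ps) /= !big_cons (perm_big _ ps') /= big_cons -/s0 es'.
  by rewrite big_cons !addrA ezw.
(* Without a positive partner for [x] the total would be negative. *)
move: s_ge0; rewrite leNgt => /negP[].
rewrite -[X in _ < X]addr0 ltr_leD //.
by rewrite big_seq sumr_le0 // => y /sN; rewrite -leNgt.
Qed.

Lemma psdmx_sum_outer_nonneg M X : symmx M -> psdmx X -> 0 <= inner M X ->
  exists s : seq 'cV[R]_n, X = \sum_(x <- s) x *m x^T /\
    forall x, x \in s -> 0 <= bform M x x.
Proof.
move=> sM /psdmx_sum_outer[s ->]; rewrite inner_sum_outer => s_ge0.
by have [s' [<- ?]] := sum_outer_nonneg sM s_ge0; exists s'.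
Qed.

Lemma bform_sum_eq0 M (s : seq 'cV[R]_n) :
  (forall x, x \in s -> 0 <= bform M x x) -> inner M (\sum_(x <- s) x *m x^T) = 0 ->
  forall x, x \in s -> bform M x x = 0.
Proof.
move=> sN; rewrite inner_sum_outer big_seq => /eqP.
rewrite psumr_eq0 // => /allP s0 x xs.
by have := s0 x xs; rewrite xs => /eqP.
Qed.

Lemma psdmx_sum_outer_isotropic M X : symmx M -> psdmx X -> inner M X = 0 ->
  exists s : seq 'cV[R]_n, X = \sum_(x <- s) x *m x^T /\
    forall x, x \in s -> bform M x x = 0.
Proof.
move=> sM pX X0; have [|s [eX sN]] := psdmx_sum_outer_nonneg sM pX; first by rewrite X0.
by exists s; split=> //; apply: bform_sum_eq0 => //; rewrite -eX.
Qed.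

End Forms.

Section Sufficiency.
Variables (R : realType) (n : nat).
Implicit Types (M N X Y P : 'M[R]_n) (x y z u v w c h k : 'cV[R]_n).

Lemma S2_outer M1 M2 x :
  0 <= bform M1 x x -> 0 <= bform M2 x x -> S2 M1 M2 (x *m x^T).
Proof. by move=> m1 m2; rewrite /S2 !inner_outer; split; [exact: psdmx_outer|]. Qed.

Lemma conv_S2 M1 M2 X :
  conv (fun Y => S2 M1 M2 Y /\ exists x, Y = x *m x^T) X -> S2 M1 M2 X.
Proof.
move=> [k [lam [Y [lam0 _ SY ->]]]].
split; last by split; rewrite inner_sum sumr_ge0 // => i _; rewrite innerZr mulr_ge0 //;
  have [[_ []]] := SY i.
split.
  rewrite /symmx linear_sum /=; apply: eq_bigr => i _.
  by rewrite linearZ /=; have [[[-> _] _] _] := SY i.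
move=> x; rewrite -/(bform _ x x) bform_sum sumr_ge0 // => i _.
by rewrite bformZm mulr_ge0 //; have [[[_ +] _] _] := SY i; apply.
Qed.

(* Adjoining the zero vector keeps the number of points positive even when [s] is empty. *)
Lemma conv_sum_outer M1 M2 (s : seq 'cV[R]_n) :
  (forall x, x \in s -> 0 <= bform M1 x x /\ 0 <= bform M2 x x) ->
  conv (fun Y => S2 M1 M2 Y /\ exists x, Y = x *m x^T) (\sum_(x <- s) x *m x^T).
Proof.
move=> sN; pose s0 : seq 'cV[R]_n := 0 :: s; pose k := size s0.
have k0 : (k%:R : R) != 0 by rewrite pnatr_eq0.
(* Scaling by [sqrt k] compensates the uniform weights [1/k]; the cone is stable under it. *)
pose y (i : 'I_k) := Num.sqrt k%:R *: nth 0 s0 i.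
have yy i : y i *m (y i)^T = k%:R *: (nth 0 s0 i *m (nth 0 s0 i)^T).
  by rewrite /y linearZ /= -scalemxAl -scalemxAr scalerA -expr2 sqr_sqrtr // ler0n.
exists k, (fun=> k%:R^-1), (fun i => y i *m (y i)^T); split.
- by move=> i; rewrite invr_ge0 ler0n.
- by rewrite sumr_const card_ord -[LHS]mulr_natl mulfV.
- move=> i; split; last by exists (y i).
  have [m1 m2] : 0 <= bform M1 (nth 0 s0 i) (nth 0 s0 i) /\
                 0 <= bform M2 (nth 0 s0 i) (nth 0 s0 i).
    have := mem_nth (0 : 'cV[R]_n) (ltn_ord i); rewrite inE => /orP[/eqP -> |/sN //].
    by rewrite /bform !mulmx0 mxE.
  by apply: S2_outer; rewrite bformZl bformZr !mulr_ge0 // sqrtr_ge0.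
transitivity (\sum_(x <- s0) x *m x^T).
  by rewrite big_cons mul0mx add0r.
rewrite (big_nth 0) big_mkord; apply: eq_bigr => i _.
by rewrite yy scalerA mulVf // scale1r.
Qed.

Lemma ROG_S2_of_sum M1 M2 :
  (forall X, S2 M1 M2 X -> exists s : seq 'cV[R]_n, X = \sum_(x <- s) x *m x^T /\
     forall x, x \in s -> 0 <= bform M1 x x /\ 0 <= bform M2 x x) ->
  ROG (S2 M1 M2).
Proof.
move=> dec X; split; last exact: conv_S2.
by move=> /dec[s [-> sN]]; exact: conv_sum_outer.
Qed.

(* Write [f = <M1,X>], [g = <M2,X>]. The decomposition of [X] is chosen so that
   every pair (M1(x), M2(x)) is a nonnegative multiple of (f, g). *)
Lemma ROG_psd_combination M1 M2 a1 a2 : symmx M1 -> symmx M2 ->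
  a1 != 0 \/ a2 != 0 -> psdmx (a1 *: M1 + a2 *: M2) -> ROG (S2 M1 M2).
Proof.
move=> s1 s2 a0 pP; apply: ROG_S2_of_sum => X [pX []].
set P := _ + _ in pP; set f := inner M1 X => f0; set g := inner M2 X => g0.
have PE x : bform P x x = a1 * bform M1 x x + a2 * bform M2 x x by rewrite !bform_linm.
have P0 x : 0 <= a1 * bform M1 x x + a2 * bform M2 x x by rewrite -PE; exact: pP.2.
have PX : inner P X = a1 * f + a2 * g by rewrite innerDl !innerZl.
have p0 : 0 <= a1 * f + a2 * g.
  rewrite -PX; have [s ->] := psdmx_sum_outer pX.
  by rewrite inner_sum_outer sumr_ge0 // => x _; exact: pP.2.
have asq : 0 < a1 ^+ 2 + a2 ^+ 2.
  by case: a0 => a0; [apply: ltr_pwDl|apply: ltr_wpDl];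
    rewrite ?sqr_ge0 // lt_neqAle sqr_ge0 eq_sym sqrf_eq0 a0.
have sC b1 b2 : symmx (b1 *: M1 + b2 *: M2) by apply: symmxD; apply: symmxZ.
have CX b1 b2 : inner (b1 *: M1 + b2 *: M2) X = b1 * f + b2 * g.
  by rewrite innerDl !innerZl.
move: p0; rewrite le_eqVlt => /orP[/eqP/esym p0|p_gt0]; last first.
  (* Isotropy for [g M1 - f M2] makes [(m1, m2)] proportional to [(f, g)]; the sign of the factor
     comes from [P]. *)
  have [|s [eX sN]] := psdmx_sum_outer_isotropic (sC g (- f)) pX.
    by rewrite CX; ring.
  exists s; split=> // x /sN; rewrite !bform_linm => e.
  have := P0 x; move: e; set m1 := bform M1 x x; set m2 := bform M2 x x => e q0.
  split; rewrite -(pmulr_rge0 _ p_gt0).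
    have -> : (a1 * f + a2 * g) * m1 = f * (a1 * m1 + a2 * m2).
      by apply: subr0_eq; transitivity (a2 * (g * m1 + - f * m2)); [ring|rewrite e; ring].
    exact: mulr_ge0.
  have -> : (a1 * f + a2 * g) * m2 = g * (a1 * m1 + a2 * m2).
    by apply: subr0_eq; transitivity (- a1 * (g * m1 + - f * m2)); [ring|rewrite e; ring].
  exact: mulr_ge0.
(* From here [<P,X> = 0], so [P] vanishes on the summands of any rank-one decomposition of [X]. *)
have P_eq0 (s : seq 'cV[R]_n) : X = \sum_(x <- s) x *m x^T ->
    forall x, x \in s -> a1 * bform M1 x x + a2 * bform M2 x x = 0.
  move=> eX x xs; rewrite -PE; apply: bform_sum_eq0 xs; last by rewrite -eX PX.
  by move=> y _; rewrite PE.
have [fg0|fg0] := eqVneq (f ^+ 2 + g ^+ 2) 0.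
  have [f_eq0 g_eq0] : f = 0 /\ g = 0.
    by move/eqP: fg0; rewrite paddr_eq0 ?sqr_ge0 // !sqrf_eq0 => /andP[/eqP ? /eqP ?].
  (* Together with [P] this form gives a linear system in [(m1, m2)] of determinant [a1^2 + a2^2],
     so both vanish. *)
  have [|s [eX sN]] := psdmx_sum_outer_isotropic (sC (- a2) a1) pX.
    by rewrite CX f_eq0 g_eq0; ring.
  exists s; split=> // x xs; move: (sN _ xs) (P_eq0 _ eX _ xs); rewrite !bform_linm.
  set m1 := bform M1 x x; set m2 := bform M2 x x => e q0.
  have m1E : (a1 ^+ 2 + a2 ^+ 2) * m1 = 0.
    by transitivity (a1 * (a1 * m1 + a2 * m2) - a2 * (- a2 * m1 + a1 * m2));
      [ring|rewrite e q0; ring].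
  have m2E : (a1 ^+ 2 + a2 ^+ 2) * m2 = 0.
    by transitivity (a2 * (a1 * m1 + a2 * m2) + a1 * (- a2 * m1 + a1 * m2));
      [ring|rewrite e q0; ring].
  by split; rewrite -(pmulr_rge0 _ asq) ?m1E ?m2E.
have fg_gt0 : 0 < f ^+ 2 + g ^+ 2 by rewrite lt_neqAle eq_sym fg0 addr_ge0 // sqr_ge0.
(* Both [(f, g)] and [(m1, m2)] are orthogonal to [(a1, a2)], hence parallel; the form [f M1 + g M2]
   makes the factor nonnegative. *)
have [|s [eX sN]] := psdmx_sum_outer_nonneg (sC f g) pX.
  by rewrite CX -!expr2 ltW.
exists s; split=> // x xs; move: (sN _ xs) (P_eq0 _ eX _ xs); rewrite !bform_linm.
set m1 := bform M1 x x; set m2 := bform M2 x x => e q0.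
have cross : f * m2 = g * m1.
  apply: (mulfI (lt0r_neq0 asq)).
  apply: subr0_eq; transitivity (a1 * (m2 * (a1 * f + a2 * g) - g * (a1 * m1 + a2 * m2))
    + a2 * (f * (a1 * m1 + a2 * m2) - m1 * (a1 * f + a2 * g))); first ring.
  by rewrite p0 q0; ring.
split; rewrite -(pmulr_rge0 _ fg_gt0).
  have -> : (f ^+ 2 + g ^+ 2) * m1 = f * (f * m1 + g * m2).
    by apply: subr0_eq; transitivity (g * (g * m1 - f * m2)); [ring|rewrite cross; ring].
  exact: mulr_ge0.
have -> : (f ^+ 2 + g ^+ 2) * m2 = g * (f * m1 + g * m2).
  by apply: subr0_eq; transitivity (f * (f * m2 - g * m1)); [ring|rewrite cross; ring].
exact: mulr_ge0.
Qed.

(* If [c^T X c > 0], subtracting the rank-one term along [X c] leaves a matrix annihilating [c],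
   all of whose rank-one summands are orthogonal to [c]. *)
Lemma ROG_common_factor (a b c : 'cV[R]_n) :
  ROG (S2 (Symm (a *m c^T)) (Symm (b *m c^T))).
Proof.
apply: ROG_S2_of_sum => X [pX []].
have innerE d : inner (Symm (d *m c^T)) X = bform X d c.
  have [s ->] := psdmx_sum_outer pX; rewrite inner_sum_outer bform_sum.
  by apply: eq_bigr => x _; rewrite bform_Symm bform_outer !(dotC x).
rewrite !innerE => aX bX.
have ker Y : psdmx Y -> Y *m c = 0 -> exists s : seq 'cV[R]_n,
    Y = \sum_(x <- s) x *m x^T /\ forall x, x \in s -> dot c x = 0.
  move=> pY Yc; have [s eY] := psdmx_sum_outer pY; exists s; split=> // x xs.
  have := bform_sum_eq0 (M := c *m c^T) (s := s) _ _ xs.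
  rewrite bform_outer (dotC x) => /(_ _ _)/eqP; rewrite mulf_eq0 orbb => c0; apply/eqP/c0.
    by move=> y _; exact: (psdmx_outer c).2.
  rewrite -eY /inner mxtrace_mulC mulmxA Yc mul0mx; exact: mxtrace0.
have := pX.2 c; rewrite -/(bform X c c) le_eqVlt => /orP[/eqP/esym c0|c_gt0].
  have [s [eX sN]] := ker _ pX (psdmx_ker pX c0).
  by exists s; split=> // x /sN xc; rewrite !bform_Symm xc !mulr0.
have [] := psdmx_peel pX c_gt0; set x := _ *: _ => pY Yc.
have [s [eY sN]] := ker _ pY Yc.
exists (x :: s); split; first by rewrite big_cons -eY addrC subrK.
move=> y; rewrite inE => /orP[/eqP->|/sN yc]; rewrite !bform_Symm ?yc ?mulr0 //.
(* As [x] is a positive multiple of [X c], its products with [a] and [b] have the signs of the two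
   constraints. *)
by rewrite !dotZr !dot_mulmx !mulr_ge0 // ?invr_ge0 ?sqrtr_ge0 // ltW.
Qed.

End Sufficiency.

(** * Positivity of polynomials near zero *)

Lemma poly_gt0_near0 (R : realFieldType) (p : {poly R}) : 0 < p.[0] ->
  exists2 d, 0 < d & forall e, 0 < e <= d -> 0 < p.[e].
Proof.
have [q [a ->]] : exists q a, p = q * 'X + a%:P.
  by elim/poly_ind: p => [|q a _]; [exists 0, 0; rewrite mul0r addr0|exists q, a].
rewrite !hornerE => a_gt0.
have [B qB] := poly_disk_bound q 1.
have B0 : 0 <= B by apply: le_trans (qB 0 _); rewrite ?normr0.
(* This radius is below 1, where [B] bounds [q], and keeps [e * B] below [a]. *)
have d_gt0 : 0 < a / (a + B + 1) by rewrite divr_gt0 //; lra.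
exists (a / (a + B + 1)) => // e /andP[e_gt0 ed].
have s_gt0 : 0 < a + B + 1 by lra.
move: ed; rewrite ler_pdivlMr // => ed.
rewrite !hornerE /=.
have e1 : `|e| <= 1 by rewrite ger0_norm ?ltW //; nra.
have := qB e e1; rewrite ler_norml => /andP[q1 q2]; nra.
Qed.

Lemma quadratic_gt0_near0 (R : realFieldType) (a b c : R) : 0 < a ->
  exists2 e, 0 < e & 0 < a + b * e + c * e ^+ 2.
Proof.
move=> a0; have [|d d0 dP] := @poly_gt0_near0 _ (a%:P + b *: 'X + c *: 'X^2).
  by have -> : (a%:P + b *: 'X + c *: 'X^2).[0] = a by rewrite !hornerE /=; ring.
by exists d => //; have := dP d; rewrite lexx d0 !hornerE /= -mulrA -expr2 => /(_ isT).
Qed.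

(** * Necessity: Finsler's lemma, the isotropic quadric and the common factor *)

Section Necessity.
Variables (R : realType) (n : nat).
Implicit Types (M N X Y P : 'M[R]_n) (x y z u v w c h k : 'cV[R]_n).

(** The ratios [M(u)/N(u)] with [N(u) > 0] lie below those with [N(v) < 0]; the supremum of the
    former serves as [l]. *)
Lemma Finsler M N u0 v0 : symmx N -> 0 < bform N u0 u0 -> bform N v0 v0 < 0 ->
  (forall x, bform N x x = 0 -> bform M x x <= 0) ->
  exists l, forall x, bform M x x <= l * bform N x x.
Proof.
move=> sN u0_gt0 v0_lt0 MN.
have cross u v : 0 < bform N u u -> bform N v v < 0 ->
    bform M u u / bform N u u <= bform M v v / bform N v v.
  (* [t] balances the two vectors so that [<N,X> = 0]; splitting [X] into isotropic terms then gives
     [<M,X> <= 0]. *)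
  move=> u_gt0 v_lt0; pose t := Num.sqrt (bform N u u / - bform N v v).
  have t2 : t ^+ 2 = bform N u u / - bform N v v.
    by rewrite sqr_sqrtr // divr_ge0 ?ltW // oppr_gt0.
  have v_neq0 : bform N v v != 0 by rewrite lt_eqF.
  pose X := u *m u^T + (t *: v) *m (t *: v)^T.
  have innerX Q : inner Q X = bform Q u u + t ^+ 2 * bform Q v v.
    by rewrite innerDr !inner_outer bformZl bformZr; ring.
  have pX : psdmx X.
    split=> [|x]; first by apply: symmxD; exact: symmx_outer.
    by rewrite -/(bform X x x) bformDm addr_ge0 //; exact: (psdmx_outer _).2.
  have [|s [eX sX]] := psdmx_sum_outer_isotropic sN pX.
    by rewrite innerX t2; field.
  have : inner M X <= 0.
    by rewrite eX inner_sum_outer big_seq sumr_le0 // => x /sX /MN.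
  rewrite innerX t2 => h.
  rewrite ler_pdivrMr // -subr_le0; apply: le_trans h.
  by rewrite le_eqVlt; apply/orP; left; apply/eqP; field.
pose E : set R := [set r | exists2 u, 0 < bform N u u & r = bform M u u / bform N u u]%classic.
have E_ub v : bform N v v < 0 -> ubound E (bform M v v / bform N v v).
  by move=> v_lt0 _ [u u_gt0 ->]; exact: cross.
have E0 : (E !=set0)%classic by exists (bform M u0 u0 / bform N u0 u0); exists u0.
exists (sup E) => x; have [x_lt0|x_gt0|x0] := ltgtP (bform N x x) 0.
- by rewrite -ler_ndivlMr //; apply: ge_sup => //; exact: E_ub.
- rewrite -ler_pdivrMr //; apply: ub_le_sup; last by exists x.
  by exists (bform M v0 v0 / bform N v0 v0); exact: E_ub.
- by rewrite x0 mulr0; exact: MN.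
Qed.

Lemma exists_isotropic_nonsingular N u v : symmx N ->
  0 < bform N u u -> bform N v v < 0 ->
  exists2 w, bform N w w = 0 & N *m w != 0.
Proof.
move=> sN u_gt0 v_lt0; have [t t0] := isotropic_combination sN v_lt0 u_gt0.
exists (t *: v + u) => //; apply/eqP => w0.
(* This pairing equals [N(u) - t^2 N(v)], which is positive. *)
have : bform N (u - t *: v) (t *: v + u) = 0 by rewrite -dot_mulmx w0 /dot mulmx0 mxE.
rewrite -scaleNr !bform_lin (bformC v u sN); have := sqr_ge0 t; nra.
Qed.

Lemma exists_isotropic_pos M N u v : symmx M -> symmx N ->
  0 < bform N u u -> bform N v v < 0 ->
  (forall l, exists x, l * bform N x x < bform M x x) ->
  exists x, [/\ bform N x x = 0, 0 < bform M x x & N *m x != 0].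
Proof.
move=> sM sN u_gt0 v_lt0 MN.
have [x [x0 x_gt0]] : exists x, bform N x x = 0 /\ 0 < bform M x x.
  apply: contrapT => none.
  have [x x0|l lP] := Finsler (M := M) sN u_gt0 v_lt0.
    by rewrite leNgt; apply/negP => x_gt0; apply: none; exists x.
  by have [x] := MN l; rewrite ltNge lP.
have [Nx|Nx] := eqVneq (N *m x) 0; last by exists x.
(* When [N x = 0], a small shift along an isotropic [w] outside the kernel keeps isotropy and the
   sign of [M]. *)
have [w w0 Nw] := exists_isotropic_nonsingular sN u_gt0 v_lt0.
have [e e_gt0 eP] := quadratic_gt0_near0 (2 * bform M x w) (bform M w w) x_gt0.
exists (x + e *: w); split.
- rewrite !bform_lin (bformC x w sN) w0 x0 -dot_mulmx Nx /dot mulmx0 mxE; ring.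
- by rewrite !bform_lin (bformC w x sM); lra.
- by rewrite mulmxDr Nx add0r -scalemxAr scaler_eq0 negb_or gt_eqF.
Qed.

(** A vector orthogonal to [x] and [z] annihilates the whole sum, hence by positivity is orthogonal
    to each [y i] of nonzero weight. *)
Lemma outer_sum_span x z (k : nat) (lam : 'I_k -> R) (y : 'I_k -> 'cV[R]_n) :
  (forall i, 0 <= lam i) ->
  x *m x^T + z *m z^T = \sum_i lam i *: (y i *m (y i)^T) ->
  forall i, lam i != 0 -> exists a b, y i = a *: x + b *: z.
Proof.
move=> lam0 eX i li.
(* The columns of [W] span the orthogonal complement of [x] and [z]. *)
pose W := cokermx (col_mx x^T z^T).
have [xW zW] : x^T *m W = 0 /\ z^T *m W = 0.
  have := mulmx_coker (col_mx x^T z^T); rewrite -/W mul_col_mx -col_mx0.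
  exact: eq_col_mx.
have yW : (y i)^T *m W = 0.
  apply/matrixP => r j; rewrite ord1 [RHS]mxE.
  have dj v : (v^T *m W) 0 j = dot v (col j W).
    by rewrite /dot !mxE; apply: eq_bigr => l _; rewrite !mxE.
  have z0 : (0 : 'rV[R]_n) 0 j = 0 by rewrite mxE.
  have := congr1 (fun A => bform A (col j W) (col j W)) eX.
  rewrite bformDm !bform_outer !(dotC (col j W)) -!dj xW zW z0 mulr0 addr0.
  rewrite bform_sum => /esym/eqP; rewrite psumr_eq0 => [/allP/(_ i (mem_index_enum i))|l _].
    rewrite bformZm bform_outer (dotC (col j W)) -dj mulf_eq0 (negPf li) /= mulf_eq0 orbb.
    by move/eqP.
  by rewrite bformZm mulr_ge0 // bform_outer dotC -expr2 sqr_ge0.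
have /submxP[D eD] : ((y i)^T <= col_mx x^T z^T)%MS by rewrite submxE -/W yW.
exists ((lsubmx D) 0 0), ((rsubmx D) 0 0).
rewrite -[LHS]trmxK eD -[D in LHS]hsubmxK mul_row_col.
rewrite [lsubmx D in LHS]mx11_scalar [rsubmx D in LHS]mx11_scalar !mul_scalar_mx.
by rewrite linearD !linearZ /= !trmxK.
Qed.

Lemma ROG_isotropic_orthogonal M1 M2 x z : symmx M1 -> symmx M2 -> ROG (S2 M1 M2) ->
  bform M2 x x = 0 -> bform M2 z z = 0 -> 0 < bform M1 x x -> bform M1 z z < 0 ->
  bform M2 x z = 0.
Proof.
move=> s1 s2 rog x0 z0 x_gt0 z_lt0; apply/eqP/negPn/negP => xz.
pose t := Num.sqrt (bform M1 x x / - bform M1 z z).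
have q_gt0 : 0 < bform M1 x x / - bform M1 z z by rewrite divr_gt0 // oppr_gt0.
have t2 : t ^+ 2 = bform M1 x x / - bform M1 z z by rewrite sqr_sqrtr // ltW.
have t0 : t != 0 by rewrite gt_eqF // sqrtr_gt0.
pose w := t *: z.
have w0 : bform M2 w w = 0 by rewrite bformZl bformZr z0 !mulr0.
have ew : bform M1 w w = - bform M1 x x.
  rewrite bformZl bformZr mulrA -expr2 t2; field; exact: ltr0_neq0.
have xw : bform M2 x w != 0 by rewrite bformZr mulf_neq0.
move: w w0 ew xw => w w0 ew xw.
pose X := x *m x^T + w *m w^T.
have X1 : inner M1 X = 0 by rewrite innerDr !inner_outer ew subrr.
have X2 : inner M2 X = 0 by rewrite innerDr !inner_outer x0 w0 addr0.
have SX : S2 M1 M2 X.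
  rewrite /S2 X1 X2; split=> //; split=> [|y]; first by apply: symmxD; exact: symmx_outer.
  by rewrite -/(bform X y y) bformDm addr_ge0 //; exact: (psdmx_outer _).2.
have /rog[k [lam [Y [lam0 _ SY eX]]]] := SX.
have [y yE] := choice (fun i => (SY i).2).
have {}eX : X = \sum_i lam i *: (y i *m (y i)^T).
  by rewrite eX; apply: eq_bigr => i _; rewrite yE.
have tight M i : inner M X = 0 -> (forall j, 0 <= inner M (Y j)) -> lam i != 0 ->
    bform M (y i) (y i) = 0.
  move=> MX MY li; move/eqP: MX; rewrite eX inner_sum psumr_eq0.
    move=> /allP/(_ i (mem_index_enum i)); rewrite innerZr inner_outer mulf_eq0 (negPf li).
    by move/eqP.
  by move=> j _; rewrite innerZr mulr_ge0 // -yE.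
(* For [y i = a x + b w] of nonzero weight, tightness of [M2] gives [a b = 0], and then that of [M1]
   gives [a = b = 0]. *)
have X_eq0 : X = 0.
  rewrite eX big1 // => i _; have [->|li] := eqVneq (lam i) 0; first by rewrite scale0r.
  have m1 : bform M1 (y i) (y i) = 0 by apply: tight => // j; have [[_ []]] := SY j.
  have m2 : bform M2 (y i) (y i) = 0 by apply: tight => // j; have [[_ []]] := SY j.
  have [a [b eY]] := outer_sum_span lam0 eX li.
  move: m1 m2; rewrite eY !bform_lin x0 w0 (bformC w x s2) ew (bformC w x s1) => m1 m2.
  have : a * b * bform M2 x w = 0 by lra.
  move/eqP; rewrite mulf_eq0 (negPf xw) orbF mulf_eq0.
  have x_neq0 : bform M1 x x != 0 by rewrite gt_eqF.
  move=> /orP[] /eqP ab; rewrite ab in m1 *.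
    have /eqP : b ^+ 2 * bform M1 x x = 0 by lra.
    rewrite mulf_eq0 (negPf x_neq0) orbF sqrf_eq0 => /eqP ->.
    by rewrite !scale0r addr0 mul0mx scaler0.
  have /eqP : a ^+ 2 * bform M1 x x = 0 by lra.
  rewrite mulf_eq0 (negPf x_neq0) orbF sqrf_eq0 => /eqP ->.
  by rewrite !scale0r addr0 mul0mx scaler0.
have x_neq0 : x != 0 by apply/eqP => xe; move: x_gt0; rewrite xe /bform mulmx0 mxE ltxx.
have : 0 < bform X x x.
  rewrite bformDm ltr_pwDl //; last exact: (psdmx_outer _).2.
  by rewrite bform_outer mulr_gt0 // dot_gt0.
by rewrite X_eq0 /bform mulmx0 mul0mx mxE ltxx.
Qed.

Lemma exists_not_orthogonal (p q : 'cV[R]_n) : p != 0 -> q != 0 ->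
  exists2 k, dot k p != 0 & dot k q != 0.
Proof.
move=> p0 q0; have [pq|pq] := eqVneq (dot p q) 0; last first.
  by exists p => //; rewrite dot_eq0.
by exists (p + q); rewrite dotDl ?(dotC q p) pq ?addr0 ?add0r dot_eq0.
Qed.

(* For [v = h + e k], the vector [N(v) x - 2 N(x,v) v] is proportional to the reflection of
   [x] in [v], hence isotropic, and up to scaling it tends to [x] when [e] tends to [0].
   Its orthogonality to [z] forces [N(z,v) = 0]. *)
Lemma isotropic_on_tangent M N x z : symmx M -> symmx N ->
  bform N x x = 0 -> 0 < bform M x x -> N *m x != 0 -> N *m z != 0 ->
  (forall y, bform N y y = 0 -> 0 < bform M y y -> bform N y z = 0) ->
  forall h, bform N x h = 0 -> bform N h h = 0.
Proof.
move=> sM sN x0 x_gt0 Nx Nz orth h xh; apply/eqP/negPn/negP => hh.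
have [k] := exists_not_orthogonal Nx Nz; rewrite !dot_mulmx => kx kz.
pose v e := h + e *: k.
pose y e := bform N (v e) (v e) *: x + (- 2 * bform N x (v e)) *: v e.
have y0 e : bform N (y e) (y e) = 0.
  by rewrite /y; move: (v e) => v'; rewrite !bform_lin x0 (bformC v' x sN); ring.
have xz : bform N x z = 0 by exact: orth.
(* [Nv] and [Xv] are [N(v)] and [-2 N(x,v)] as polynomials in [e]; since [N(x,h) = 0], the constant
   term of [p] is [N(h)^2 M(x) > 0]. *)
pose Nv : {poly R} := (bform N h h)%:P + (2 * bform N h k) *: 'X + bform N k k *: 'X^2.
pose Xv : {poly R} := (-2 * bform N k x) *: 'X.
pose p : {poly R} := Nv ^+ 2 * (bform M x x)%:P
  + Nv * Xv * (2 *: ((bform M x h)%:P + bform M x k *: 'X))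
  + Xv ^+ 2 * ((bform M h h)%:P + (2 * bform M h k) *: 'X + bform M k k *: 'X^2).
have pE e : bform M (y e) (y e) = p.[e].
  rewrite /y /v /p /Nv /Xv !hornerE /= !bform_lin.
  rewrite xh (bformC h x sM) (bformC k x sM) (bformC k h sM) (bformC k h sN) (bformC k x sN).
  ring.
have [|d d_gt0 dP] := @poly_gt0_near0 _ p.
  rewrite /p /Nv /Xv !hornerE /=.
  have h2 : 0 < bform N h h ^+ 2 by rewrite lt_neqAle sqr_ge0 eq_sym sqrf_eq0 hh.
  have : 0 < bform N h h ^+ 2 * bform M x x by exact: mulr_gt0.
  lra.
have lin e : 0 < e <= d -> bform N h z + e * bform N k z = 0.
  move=> ed; have /andP[e_gt0 _] := ed.
  have := orth (y e) (y0 e); rewrite pE => /(_ (dP e ed)).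
  rewrite /y bformDl 2!bformZl xz mulr0 add0r {1}/v !bform_lin xh add0r => /eqP.
  rewrite (bformC x k sN) !mulf_eq0 (negPf kx) (gt_eqF e_gt0) oppr_eq0 pnatr_eq0 /=.
  by move/eqP.
(* An affine function of [e] with two zeros has slope [N(k,z) = 0], against the choice of [k]. *)
have l1 := lin d; have l2 := lin (d / 2).
have {}l1 : bform N h z + d * bform N k z = 0 by apply: l1; rewrite d_gt0 lexx.
have {}l2 : bform N h z + d / 2 * bform N k z = 0 by apply: l2; apply/andP; split; lra.
have /eqP : d * bform N k z = 0 by lra.
by rewrite mulf_eq0 (negPf kz) gt_eqF.
Qed.

(** [M] vanishes at the projection of [y] orthogonal to [c]; expanding this shows [M(y)] as [c·y]
    times a linear form in [y], which determines [a]. *)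
Lemma Symm_factor M c : symmx M -> c != 0 ->
  (forall h, dot c h = 0 -> bform M h h = 0) -> exists a, M = Symm (a *m c^T).
Proof.
move=> sM c0 Mc; have c_gt0 := dot_gt0 c0.
have cn0 : dot c c != 0 by rewrite gt_eqF.
exists ((2 / dot c c) *: (M *m c) + (- (bform M c c / dot c c ^+ 2)) *: c).
apply: symmx_bform_inj => //; first exact: symmx_Symm.
move=> y; rewrite bform_Symm dotDl !dotZl (dotC (M *m c)) dot_mulmx.
have := Mc (y + (- (dot c y / dot c c)) *: c).
rewrite dotDr dotZr => /(_ _) H.
have {H} : bform M (y + (- (dot c y / dot c c)) *: c) (y + (- (dot c y / dot c c)) *: c) = 0.
  by apply: H; field.
rewrite !bform_lin (bformC c y sM) => e; apply: subr0_eq.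
by rewrite -[RHS]e; field.
Qed.

Lemma ROG_implies_common_factor M1 M2 : symmx M1 -> symmx M2 -> ROG (S2 M1 M2) ->
  (forall a1 a2, a1 != 0 \/ a2 != 0 ->
     exists x, a1 * bform M1 x x + a2 * bform M2 x x < 0) ->
  exists a b c, M1 = Symm (a *m c^T) /\ M2 = Symm (b *m c^T).
Proof.
move=> s1 s2 rog indef; set N := M2 in s2 *.
have [v0 v0_lt0] : exists v, bform N v v < 0.
  by have [|v vP] := indef 0 1; [right; exact: oner_neq0|exists v; lra].
have [u0 u0_gt0] : exists u, 0 < bform N u u.
  have [|u uP] := indef 0 (-1); first by right; rewrite oppr_eq0 oner_neq0.
  by exists u; lra.
have sN1 : symmx ((-1) *: M1) by exact: symmxZ.
(* The negative values of [l M2 - M1], and below of [l M2 + M1], rule out every Finsler multiplier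
   [l]. *)
have [l|x [x0 x_gt0 Nx]] := exists_isotropic_pos s1 s2 u0_gt0 v0_lt0.
  have [|x xP] := indef (-1) l; first by left; rewrite oppr_eq0 oner_neq0.
  by exists x; lra.
have [l|z [z0 z_lt0 Nz]] := exists_isotropic_pos sN1 s2 u0_gt0 v0_lt0.
  have [|x' xP] := indef 1 l; first by left; exact: oner_neq0.
  by exists x'; rewrite bformZm; lra.
have {}z_lt0 : bform M1 z z < 0 by move: z_lt0; rewrite bformZm; lra.
have orth y w : bform N y y = 0 -> bform N w w = 0 ->
    0 < bform M1 y y -> bform M1 w w < 0 -> bform N y w = 0.
  exact: ROG_isotropic_orthogonal.
pose v := N *m x.
have dv y : dot v y = bform N x y by rewrite dotC dot_mulmx (bformC _ _ s2).
move: v dv (Nx : v != 0) => v dv v_neq0.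
have [|u eN] := Symm_factor s2 v_neq0.
  move=> h; rewrite dv; apply: (isotropic_on_tangent s1 s2 x0 x_gt0 Nx Nz).
  by move=> y y0 y_gt0; exact: orth.
have polar y w : 2 * bform N y w = dot u y * dot v w + dot v y * dot u w.
  rewrite eN /Symm bformZm bformDm trmx_mul trmxK !bform_outer !(dotC y); lra.
have vx : dot v x = 0 by rewrite dv.
have vz : dot v z = 0 by rewrite dv; exact: orth.
have vv : 0 < dot v v by exact: dot_gt0.
have ux : dot u x = 2.
  have := polar x v; rewrite -dv vx mul0r addr0 => e.
  by apply: (mulIf (lt0r_neq0 vv)).
have uz : dot u z != 0.
  apply/eqP => uz; move/eqP: Nz; apply; apply/eqP; rewrite -dot_eq0 dot_mulmx.
  have := polar (N *m z) z; rewrite uz vz; set q := bform _ _ _; lra.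
have u_neq0 : u != 0.
  by apply/eqP => ue; move: ux; rewrite ue dotC /dot mulmx0 mxE => /eqP; rewrite eq_sym pnatr_eq0.
(* As [u·x = 2] and [v·x = 0], this vector is orthogonal to [u] but not to [v]. *)
pose w0 := 2 *: v + (- dot u v) *: x.
have uw0 : dot u w0 = 0 by rewrite dotDr !dotZr ux; ring.
have vw0 : dot v w0 != 0.
  by rewrite dotDr !dotZr vx mulr0 addr0 mulf_neq0 ?pnatr_eq0 // gt_eqF.
move: w0 uw0 vw0 => w0 uw0 vw0.
have Nu w : dot u w = 0 -> bform N w w = 0.
  by move=> uw; have := polar w w; rewrite uw; set q := bform _ _ _; lra.
have vperp w : dot u w = 0 -> bform M1 w w != 0 -> dot v w = 0.
  move=> uw; rewrite neq_lt => /orP[w_lt0|w_gt0].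
    by rewrite dv; apply: orth => //; exact: Nu.
  have wz : bform N w z = 0 by apply: orth => //; exact: Nu.
  have := polar w z; rewrite wz uw mulr0 mul0r add0r => /esym/eqP.
  by rewrite mulf_eq0 (negPf uz) orbF => /eqP.
have [|a eM] := Symm_factor s1 u_neq0; last first.
  exists a, v, u; split=> //; rewrite eN /Symm !trmx_mul !trmxK.
  by rewrite addrC.
move=> w uw; apply/eqP/negPn/negP => w_neq0.
(* The perturbed vector stays orthogonal to [u] with [M1] nonzero, but its product with [v] is no
   longer zero, against [vperp]. *)
have [e e_neq0 eP] : exists2 e, e != 0 & bform M1 (w + e *: w0) (w + e *: w0) != 0.
  move: w_neq0; rewrite neq_lt => /orP[w_lt0|w_gt0].
    have nw : 0 < - bform M1 w w by rewrite oppr_gt0.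
    have [e e_gt0 eP] := quadratic_gt0_near0 (- 2 * bform M1 w w0) (- bform M1 w0 w0) nw.
    exists e; first by rewrite gt_eqF.
    by rewrite lt_eqF // -oppr_gt0 !bform_lin (bformC w0 w s1); lra.
  have [e e_gt0 eP] := quadratic_gt0_near0 (2 * bform M1 w w0) (bform M1 w0 w0) w_gt0.
  exists e; first by rewrite gt_eqF.
  by rewrite gt_eqF // !bform_lin (bformC w0 w s1); lra.
have := vperp (w + e *: w0); rewrite dotDr dotZr uw uw0 mulr0 addr0 => /(_ erefl eP).
rewrite dotDr dotZr (vperp w) // add0r => /eqP.
by rewrite mulf_eq0 (negPf e_neq0) (negPf vw0).
Qed.

End Necessity.

Theorem theorem4p1 (R : realType) (n : nat) (M1 M2 : 'M[R]_n) :
  symmx M1 -> symmx M2 ->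
  (ROG (S2 M1 M2) <->
   ((exists a1 a2 : R, (a1 != 0 \/ a2 != 0) /\ psdmx (a1 *: M1 + a2 *: M2))
    \/ (exists a b c : 'cV[R]_n,
          M1 = Symm (a *m c^T) /\ M2 = Symm (b *m c^T)))).
Proof.
move=> s1 s2; split=> [rog|[[a1 [a2 [a0 pP]]]|[a [b [c [-> ->]]]]]]; last first.
- exact: ROG_common_factor.
- exact: ROG_psd_combination pP.
have [?|npsd] := pselect (exists a1 a2 : R,
  (a1 != 0 \/ a2 != 0) /\ psdmx (a1 *: M1 + a2 *: M2)); first by left.
right; apply: ROG_implies_common_factor => // a1 a2 a0.
apply: contrapT => none; apply: npsd; exists a1, a2; split=> //.
split=> [|x]; first by apply: symmxD; exact: symmxZ.
rewrite -/(bform _ x x) !bform_linm leNgt; apply/negP => x_lt0.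
by apply: none; exists x.
Qed.
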